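(* For all integers $\alpha\ge 1$, $$\frac{1}{8^{\alpha}}L_{\alpha}\in\mathbb{Z}[x],$$ i.e. $L_\alpha/8^\alpha$ is a polynomial in the function $x$ with integer coefficients.
   Context: Let $q=e^{2\pi i\tau}$ with $\tau\in\mathbb{H}$ (the upper half plane); all functions below may be identified with their $q$-expansions. Write $(q^a;q^b)_\infty=\prod_{m=0}^\infty(1-q^{a+bm})$. The integers $d_7(n)$ are defined by $$\sum_{n=0}^{\infty}d_7(n)q^n = \prod_{m=1}^{\infty}\frac{(1-q^{2m})^7}{(1-q^m)^{22}}.$$ For $\alpha\ge 1$ let $\lambda_\alpha$ be the minimal positive integer $y$ with $3y\equiv 1\pmod{4^\alpha}$, and define $$L_{\alpha} := \frac{(q;q)^{26}_{\infty}(q^4;q^4)^{2}_{\infty}}{(q^2;q^2)^{13}_{\infty}}\sum_{n=0}^{\infty}d_7(4^{\alpha}n+\lambda_{\alpha})q^{n+1}.$$ The function $x$ is $$x := q\,\frac{(q^2;q^2)^2_{\infty}(q^8;q^8)^4_{\infty}}{(q;q)^4_{\infty}(q^4;q^4)^2_{\infty}}.$$ *)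

(* Defs.v *)
From HB Require Import structures.
From mathcomp Require Import all_boot all_order all_algebra.
From mathcomp Require Import boolp.

Set Implicit Arguments.
Unset Strict Implicit.
Unset Printing Implicit Defensive.

Import Order.TTheory GRing.Theory Num.Theory.
Local Open Scope ring_scope.

(* Formal power series in one variable q; [f n] is the coefficient of q^n.    *)

Record fps (R : Type) := Fps { fps_coef :> nat -> R }.

Notation "{ 'fps' R }" := (fps R) (at level 0, format "{ 'fps'  R }").

Lemma fpsP (R : Type) (f g : {fps R}) : f =1 g <-> f = g.
Proof.
split=> [|-> //]; case: f g => [f] [g] /= fg.
by congr Fps; apply: funext.
Qed.

HB.instance Definition _ (R : Type) := gen_eqMixin {fps R}.
HB.instance Definition _ (R : Type) := gen_choiceMixin {fps R}.

Section FpsZmodule.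
Variable R : zmodType.
Implicit Types f g h : {fps R}.

Definition fps_zero : {fps R} := Fps (fun=> 0).
Definition fps_add f g : {fps R} := Fps (fun n => f n + g n).
Definition fps_opp f : {fps R} := Fps (fun n => - f n).

Lemma fps_addA : associative fps_add.
Proof. by move=> f g h; apply/fpsP => n /=; rewrite addrA. Qed.
Lemma fps_addC : commutative fps_add.
Proof. by move=> f g; apply/fpsP => n /=; rewrite addrC. Qed.
Lemma fps_add0 : left_id fps_zero fps_add.
Proof. by move=> f; apply/fpsP => n /=; rewrite add0r. Qed.
Lemma fps_addN : left_inverse fps_zero fps_opp fps_add.
Proof. by move=> f; apply/fpsP => n /=; rewrite addNr. Qed.

HB.instance Definition _ := GRing.isZmodule.Build {fps R}
  fps_addA fps_addC fps_add0 fps_addN.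

Lemma coef_fps0 n : (0 : {fps R}) n = 0. Proof. by []. Qed.
Lemma coef_fpsD f g n : (f + g) n = f n + g n. Proof. by []. Qed.
Lemma coef_fpsN f n : (- f) n = - f n. Proof. by []. Qed.
Lemma coef_fpsB f g n : (f - g) n = f n - g n. Proof. by []. Qed.

Lemma coef_fps_sum I (r : seq I) (P : pred I) (F : I -> {fps R}) n :
  (\sum_(i <- r | P i) F i) n = \sum_(i <- r | P i) F i n.
Proof. by elim/big_rec2: _ => //= i x y _ <-. Qed.

End FpsZmodule.

Section FpsRing.
Variable R : comNzRingType.
Implicit Types f g h : {fps R}.

Definition fps_one : {fps R} := Fps (fun n => (n == 0%N)%:R).
Definition fps_mul f g : {fps R} :=
  Fps (fun n => \sum_(i < n.+1) f i * g (n - i)%N).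

Definition fps_trunc N f : {poly R} := \poly_(i < N) f i.

Lemma coef_fps_trunc N f n :
  (fps_trunc N f)`_n = if (n < N)%N then f n else 0.
Proof. exact: coef_poly. Qed.

Lemma fps_mul_trunc N f g n : (n < N)%N ->
  fps_mul f g n = (fps_trunc N f * fps_trunc N g)`_n.
Proof.
move=> nN; rewrite coefM /=; apply: eq_bigr => i _.
rewrite !coef_fps_trunc (leq_ltn_trans _ nN) ?leq_ord //.
by rewrite (leq_ltn_trans _ nN) ?leq_subr.
Qed.

Lemma fps_mulC : commutative fps_mul.
Proof.
move=> f g; apply/fpsP => n.
by rewrite !(@fps_mul_trunc n.+1) // mulrC.
Qed.

Lemma fps_mulA : associative fps_mul.
Proof.
move=> f g h; apply/fpsP => n.
transitivity (fps_trunc n.+1 f * fps_trunc n.+1 g * fps_trunc n.+1 h)`_n.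
  rewrite -mulrA coefM; apply: eq_bigr => i _.
  by rewrite coef_fps_trunc ltn_ord (@fps_mul_trunc n.+1) // ltnS leq_subr.
rewrite coefM; apply: eq_bigr => i _.
by rewrite (@fps_mul_trunc n.+1) // coef_fps_trunc ltnS leq_subr.
Qed.

Lemma fps_mul1 : left_id fps_one fps_mul.
Proof.
move=> f; apply/fpsP => n /=.
rewrite big_ord_recl /= mul1r subn0 big1 ?addr0 // => i _.
by rewrite mul0r.
Qed.

Lemma fps_mulDl : left_distributive fps_mul +%R.
Proof.
move=> f g h; apply/fpsP => n /=.
by rewrite -big_split; apply: eq_bigr => i _; rewrite mulrDl.
Qed.

Lemma fps_one_neq0 : fps_one != 0.
Proof.
apply/eqP => /(congr1 (fun f : {fps R} => f 0%N)) /= /eqP.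
by rewrite oner_eq0.
Qed.

HB.instance Definition _ := GRing.Zmodule_isComNzRing.Build {fps R}
  fps_mulA fps_mulC fps_mul1 fps_mulDl fps_one_neq0.

Lemma coef_fps1 n : (1 : {fps R}) n = (n == 0%N)%:R. Proof. by []. Qed.
Lemma coef_fpsM f g n : (f * g) n = \sum_(i < n.+1) f i * g (n - i)%N.
Proof. by []. Qed.
Lemma coef_fpsM0 f g : (f * g) 0%N = f 0%N * g 0%N.
Proof. by rewrite coef_fpsM big_ord1. Qed.

Definition fpsC (c : R) : {fps R} := Fps (fun n => c *+ (n == 0%N)).
Definition fpsX : {fps R} := Fps (fun n => (n == 1%N)%:R).

Lemma coef_fpsCM c f n : (fpsC c * f) n = c * f n.
Proof.
rewrite coef_fpsM big_ord_recl /= mulr1n subn0 big1 ?addr0 // => i _.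
by rewrite mul0r.
Qed.

Lemma coef_fpsXM f n : (fpsX * f) n = if n is k.+1 then f k else 0.
Proof.
rewrite coef_fpsM; case: n => [|n]; first by rewrite big_ord1 /= mul0r.
rewrite big_ord_recl /= mul0r add0r big_ord_recl /= mul1r subSS subn0.
by rewrite big1 ?addr0 // => i _; rewrite mul0r.
Qed.

Lemma coef_fpsXnM k f n :
  (fpsX ^+ k * f) n = if (n < k)%N then 0 else f (n - k)%N.
Proof.
elim: k n => [|k IH] n; first by rewrite expr0 mul1r subn0.
rewrite exprS -mulrA coef_fpsXM; case: n => [//|n].
by rewrite IH ltnS subSS.
Qed.

(* f has no term of degree less than k.                                       *)
Definition fps_small k f := forall n, (n < k)%N -> f n = 0.

Lemma fps_smallM k l f g :
  fps_small k f -> fps_small l g -> fps_small (k + l) (f * g).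
Proof.
move=> fk gl n nkl; rewrite coef_fpsM big1 // => i _.
have [/fk -> | ki] := ltnP i k; first by rewrite mul0r.
rewrite [g _]gl ?mulr0 // ltn_subLR ?leq_ord //.
by apply: leq_trans nkl _; rewrite leq_add2r.
Qed.

Lemma fps_smallX k f : fps_small 1 f -> fps_small k (f ^+ k).
Proof.
move=> f1; elim: k => [|k IH] //.
by rewrite exprS -add1n; apply: fps_smallM.
Qed.

(* The infinite product F 0 * F 1 * F 2 * ..., for factors satisfying         *)
(* F m = 1 + O(q^(m+1)): the coefficient of q^n is then that of every partial *)
(* product with more than n factors (fps_prod_infE), and we read it off the   *)
(* one with n+1 factors.                                                      *)
Definition fps_prod_inf (F : nat -> {fps R}) : {fps R} :=
  Fps (fun n => (\prod_(m < n.+1) F m) n).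

Lemma fps_prod_infE (F : nat -> {fps R}) n N :
  (forall m, fps_small m.+1 (F m - 1)) -> (n < N)%N ->
  fps_prod_inf F n = (\prod_(m < N) F m) n.
Proof.
move=> F1; elim: N => // N IH; rewrite ltnS leq_eqVlt => /orP[/eqP-> //|nN].
rewrite IH // big_ord_recr; set P := \prod_(m < N) F m.
transitivity ((P * (F N - 1) + P) n); last by rewrite mulrBr mulr1 subrK.
rewrite coef_fpsD (_ : (P * (F N - 1)) n = 0) ?add0r //.
by apply: (@fps_smallM 0 N.+1) => //; rewrite add0n ltnS ltnW.
Qed.

End FpsRing.

Section FpsInv.
Variable R : comUnitRingType.
Implicit Types f g h : {fps R}.

Definition fps_unit : pred {fps R} := fun f => f 0%N \is a GRing.unit.

(* 1/f = u / (1 - h) = u (1 + h + h^2 + ...), with u = 1/f(0), h = 1 - u f.   *)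
Definition fps_inv f : {fps R} :=
  if fps_unit f then
    fpsC (f 0%N)^-1 *
      Fps (fun n => (\sum_(k < n.+1) (1 - fpsC (f 0%N)^-1 * f) ^+ k) n)
  else f.

Lemma fps_mulVr : {in fps_unit, left_inverse 1 fps_inv *%R}.
Proof.
move=> f fu; have f0 : f 0%N \is a GRing.unit := fu.
rewrite /fps_inv (fu : fps_unit f).
set u := fpsC _; set h := 1 - u * f; set G := Fps _.
have h1 : fps_small 1 h.
  by case=> // _; rewrite coef_fpsB coef_fpsCM mulVr // subrr.
rewrite mulrAC (_ : u * f = 1 - h); last by rewrite /h subKr.
apply/fpsP => n; transitivity (((1 - h) * \sum_(k < n.+1) h ^+ k) n).
  rewrite !coef_fpsM; apply: eq_bigr => i _; congr (_ * _).
  have ni : (n - i < n.+1)%N by rewrite ltnS leq_subr.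
  rewrite /G /= (big_ord_widen n.+1 (fun k => h ^+ k)) // !coef_fps_sum.
  rewrite big_mkcond /=; apply: eq_bigr => k _; case: ltnP => // ki.
  by rewrite (fps_smallX h1).
by rewrite -opprB mulNr -subrX1 opprB coef_fpsB (fps_smallX h1) ?subr0.
Qed.

Lemma fps_unitPl f g : g * f = 1 -> fps_unit f.
Proof.
move=> /(congr1 (fun f : {fps R} => f 0%N)).
rewrite coef_fpsM0 coef_fps1 eqxx => gf.
by apply/unitrP; exists (g 0%N); rewrite [in X in _ /\ X]mulrC.
Qed.

Lemma fps_inv_out : {in [predC fps_unit], fps_inv =1 id}.
Proof. by move=> f nfu; rewrite /fps_inv ifN. Qed.

HB.instance Definition _ := GRing.ComNzRing_hasMulInverse.Build {fps R}
  fps_mulVr fps_unitPl fps_inv_out.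

Lemma fps_unitE f : (f \is a GRing.unit) = (f 0%N \is a GRing.unit).
Proof. by []. Qed.

End FpsInv.

Arguments fpsX {R}.
Notation "''q'" := (@fpsX _) (at level 0) : ring_scope.

(* (q^a; q^b)_oo, for a, b >= 1.                                              *)
Definition qpoch (R : comNzRingType) (a b : nat) : {fps R} :=
  fps_prod_inf (fun m => 1 - 'q ^+ (a + b * m)).
Arguments qpoch {R} a b.

Lemma qpochE (R : comNzRingType) a b n N :
  (0 < a)%N -> (0 < b)%N -> (n < N)%N ->
  (qpoch a b : {fps R}) n = (\prod_(m < N) (1 - 'q ^+ (a + b * m))) n.
Proof.
move=> a0 b0; apply: fps_prod_infE => m k km.
rewrite addrC addKr coef_fpsN -[_ ^+ _]mulr1 coef_fpsXnM.
rewrite (leq_trans km) ?oppr0 // -(add1n m).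
by rewrite leq_add // leq_pmull.
Qed.

(* The factor with index m >= 1 of the generating product is at position m-1. *)
Definition d7_factor (m : nat) : {fps int} :=
  (1 - 'q ^+ (2 * m)) ^+ 7 / (1 - 'q ^+ m) ^+ 22.

Lemma fps_small_d7_factor m : fps_small m.+1 (d7_factor m.+1 - 1).
Proof.
pose C (f : {fps int}) := fps_small m.+1 (f - 1).
have CM f g : C f -> C g -> C (f * g).
  move=> Cf Cg k km; rewrite (_ : _ - 1 = (f - 1) * g + (g - 1)).
    rewrite coef_fpsD Cg // addr0.
    by apply: (@fps_smallM _ m.+1 0) => //; rewrite addn0.
  by rewrite mulrBl mul1r addrA subrK.
have CX f j : C f -> C (f ^+ j).
  move=> Cf; elim: j => [|j IH]; first by rewrite expr0 /C subrr.
  by rewrite exprS; apply: CM.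
have CV f : C f -> C f^-1.
  move=> Cf k km.
  have fu : f \is a GRing.unit.
    rewrite fps_unitE (_ : f 0%N = 1) ?unitr1 //.
    by apply/eqP; rewrite -subr_eq0; apply/eqP/(Cf 0%N).
  rewrite (_ : _ - 1 = - ((f - 1) * f^-1)).
    rewrite coef_fpsN (@fps_smallM _ m.+1 0 _ f^-1) ?oppr0 ?addn0 //.
  by rewrite mulrBl mul1r divrr // opprB.
have Cq j : (m < j)%N -> C (1 - 'q ^+ j).
  move=> mj k km; rewrite addrC addKr coef_fpsN -['q ^+ _]mulr1 coef_fpsXnM.
  by rewrite (leq_trans km) ?oppr0.
by apply: CM; [|apply: CV]; apply: CX; apply: Cq; rewrite // leq_pmull.
Qed.

Definition d7 (n : nat) : int := fps_prod_inf (fun m => d7_factor m.+1) n.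

Lemma d7E n N : (n < N)%N -> d7 n = (\prod_(m < N) d7_factor m.+1) n.
Proof. by apply: fps_prod_infE => m; apply: fps_small_d7_factor. Qed.

Lemma lambda_exists (alpha : nat) :
  exists y, (0 < y)%N && (3 * y == 1 %[mod 4 ^ alpha]).
Proof.
exists (chinese 3 (4 ^ alpha) 0 1 %/ 3 + 4 ^ alpha)%N.
rewrite addn_gt0 expn_gt0 orbT /= mulnDr mulnC divnK.
  have co : coprime 3 (4 ^ alpha) by rewrite coprimeXr.
  by rewrite -modnDmr modnMl addn0 chinese_modr.
have co : coprime 3 (4 ^ alpha) by rewrite coprimeXr.
by rewrite /dvdn chinese_modl.
Qed.

Definition lambda (alpha : nat) : nat := ex_minn (lambda_exists alpha).

Definition L (alpha : nat) : {fps rat} :=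
  qpoch 1 1 ^+ 26 * qpoch 4 4 ^+ 2 / qpoch 2 2 ^+ 13
  * Fps (fun k => if k is n.+1 then (d7 (4 ^ alpha * n + lambda alpha))%:~R
                  else 0).

Definition x : {fps rat} :=
  'q * (qpoch 2 2 ^+ 2 * qpoch 8 8 ^+ 4 / (qpoch 1 1 ^+ 4 * qpoch 4 4 ^+ 2)).

(* Main.v *)
Require Import Defs.
From HB Require Import structures.
From mathcomp Require Import all_boot all_order all_algebra.
From mathcomp Require Import boolp ring zify.
Import Order.TTheory GRing.Theory Num.Theory.
Local Open Scope ring_scope.

(* In terms of phi(q) = sum q^(n^2) and psi(q) = sum_(n >= 0) q^(n(n+1)/2), the
   passage from [L alpha] to [L (alpha + 1)] is the operator
     T f = phi(q) theta phi(-q)^12 U_4 (q f / phi(-q)^13),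
   where theta = psi(q^2) / phi(q).  With t = 2 q theta(q^4), the 4-dissection of
   phi(-q) reads phi(-q) = phi(q^4) (1 - t), whence x = t / (2 (1 - t)^2), and t^4 is
   a series in q^4: U_4 (t^4) = tau, where y^2 tau = 16 W for y = 1 + 8 x and
   W = x (1 + 4 x).  Clearing the denominator of (1 - t)^(-m) with
   1 - t^4 = (1 - t) (1 + t) (1 + t^2) turns T ((2 x)^k) into 8 W r_k(8 x) with an
   explicit integer polynomial r_k.  Since r_1 is even, T maps the lattice W Z[8 x]
   into 8 W Z[8 x], which contains [L 1]; so [L alpha] lies in 8^alpha W Z[8 x].

   Only one theta series needs to be matched with its product: phi(-q), by Shanks'
   finite form of Gauss' identity.  The equation psi(q)^2 = phi(q) psi(q^2), which
   follows from it, determines psi. *)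

Set Implicit Arguments.
Unset Strict Implicit.
Unset Printing Implicit Defensive.

(** * Substitutions in formal power series *)

(** Reindexes a convolution one factor of which is supported on the multiples of k. Both the
    multiplicativity of dilation and the linearity of U_k over series in q^k rest on it. *)
Lemma sum_multiples (V : nmodType) (k n : nat) (F : nat -> V) : (0 < k)%N ->
  \sum_(i < (k * n).+1) (if (k %| i)%N then F (i %/ k)%N else 0)
    = \sum_(j < n.+1) F j.
Proof.
move=> k0; rewrite -(big_mkord xpredT (fun i => if (k %| i)%N then F (i %/ k)%N else 0)).
elim: n => [|n IH]; first by rewrite muln0 big_nat1 dvdn0 div0n big_ord1.
rewrite big_ord_recr -IH (@big_cat_nat _ _ _ (k * n).+1) //=; last first.
  by rewrite ltnS leq_pmul2l.
congr (_ + _); rewrite big_nat_recr /=; last by rewrite ltn_pmul2l.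
rewrite dvdn_mulr // mulKn // big1_seq ?add0r // => i /=.
rewrite mem_index_iota => /andP[ni iN]; case: ifP => // /dvdnP[j ij].
move: ni iN; rewrite ij [(j * k)%N]mulnC !ltn_pmul2l //; lia.
Qed.

Section Dilation.
Variable R : comNzRingType.
Implicit Types f g : {fps R}.

Lemma coef_fps_nat (m n : nat) : (m%:R : {fps R}) n = if n == 0%N then m%:R else 0.
Proof.
elim: m => [|m IH]; first by case: ifP.
rewrite -[m.+1]addn1 natrD coef_fpsD IH coef_fps1 natrD.
by case: (n == 0)%N; rewrite ?addr0.
Qed.

(** The substitution f(q^k). For k = 0 only the constant term remains, so this is a ring morphism
    for every k. *)
Definition fps_dil (k : nat) f : {fps R} :=
  Fps (fun n => if (k %| n)%N then f (n %/ k)%N else 0).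

Lemma coef_dil (k : nat) f (n : nat) :
  fps_dil k f n = if (k %| n)%N then f (n %/ k)%N else 0.
Proof. by []. Qed.

Lemma fps_dil_is_zmod_morphism (k : nat) : zmod_morphism (fps_dil k).
Proof.
move=> f g; apply/fpsP => n; rewrite coef_fpsB !coef_dil.
by case: ifP; rewrite ?subr0.
Qed.

Lemma fps_dil_is_monoid_morphism (k : nat) : GRing.monoid_morphism (fps_dil k).
Proof.
split.
  apply/fpsP => n; rewrite coef_dil !coef_fps1.
  case: k n => [|k] [|n] //=; case: ifP => // /dvdnP[[|j] // E].
  by rewrite E mulnK.
move=> f g; apply/fpsP => n; rewrite coef_dil !coef_fpsM; case: ifP => [kn|nkn].
  have [k0|k0] := posnP k; first last.
    case/dvdnP: kn => m ->; rewrite mulnK // mulnC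
      -(@sum_multiples _ k m (fun j => f j * g (m - j)%N)) //.
    apply: eq_bigr => i _; rewrite !coef_dil; case: ifP => [ki|]; last by rewrite mul0r.
    have ile : (i <= k * m)%N by rewrite -ltnS.
    by rewrite dvdn_subr ?dvdn_mulr // ki divnBl ?dvdn_mulr // mulKn // ki subn0.
  by move: kn; rewrite k0 dvd0n => /eqP->; rewrite !big_ord1.
rewrite big1 // => i _; rewrite !coef_dil.
have [ki|] := ifP (k %| i)%N; last by rewrite mul0r.
case: ifP => [kni|]; last by rewrite mulr0.
by have := dvdn_add ki kni; rewrite subnKC ?nkn // -ltnS.
Qed.

HB.instance Definition _ (k : nat) :=
  GRing.isZmodMorphism.Build {fps R} {fps R} (fps_dil k) (fps_dil_is_zmod_morphism k).
HB.instance Definition _ (k : nat) :=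
  GRing.isMonoidMorphism.Build {fps R} {fps R} (fps_dil k) (fps_dil_is_monoid_morphism k).

End Dilation.

Section Substitutions.
Variable R : comNzRingType.
Implicit Types f g : {fps R}.

(** The substitution f(-q). *)
Definition fps_neg f : {fps R} := Fps (fun n => (-1) ^+ n * f n).

Lemma coef_neg f (n : nat) : fps_neg f n = (-1) ^+ n * f n.
Proof. by []. Qed.

Lemma fps_neg_is_zmod_morphism : zmod_morphism fps_neg.
Proof. by move=> f g; apply/fpsP => n; rewrite coef_fpsB !coef_neg mulrBr. Qed.

Lemma fps_neg_is_monoid_morphism : GRing.monoid_morphism fps_neg.
Proof.
split.
  apply/fpsP => n; rewrite coef_neg coef_fps1.
  by case: n => [|n] /=; rewrite ?expr0 ?mulr1 ?mulr0.
move=> f g; apply/fpsP => n; rewrite coef_neg !coef_fpsM mulr_sumr.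
apply: eq_bigr => i _; rewrite !coef_neg mulrACA -exprD subnKC //.
by rewrite -ltnS.
Qed.

HB.instance Definition _ :=
  GRing.isZmodMorphism.Build {fps R} {fps R} fps_neg fps_neg_is_zmod_morphism.
HB.instance Definition _ :=
  GRing.isMonoidMorphism.Build {fps R} {fps R} fps_neg fps_neg_is_monoid_morphism.

(* The operator U_k of the theory of modular forms. *)
Definition fps_dec (k : nat) f : {fps R} := Fps (fun n => f (k * n)%N).

Lemma fps_dec_is_zmod_morphism (k : nat) : zmod_morphism (fps_dec k).
Proof. by move=> f g; apply/fpsP. Qed.

HB.instance Definition _ (k : nat) :=
  GRing.isZmodMorphism.Build {fps R} {fps R} (fps_dec k) (fps_dec_is_zmod_morphism k).

(** Series in q^k are scalars for U_k; every evaluation of U_4 below pulls them out in this way. *)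
Lemma fps_dec_dilM (k : nat) f g : (0 < k)%N ->
  fps_dec k (fps_dil k f * g) = f * fps_dec k g.
Proof.
move=> k0; apply/fpsP => n; rewrite /= -[LHS]/((fps_dil k f * g) (k * n)%N).
rewrite !coef_fpsM -(@sum_multiples _ k n (fun j => f j * g (k * (n - j))%N)) //.
apply: eq_bigr => i _; rewrite coef_dil; case: ifP => [ki|]; last by rewrite mul0r.
by case/dvdnP: ki => j ->; rewrite mulnK // mulnBr [(k * j)%N]mulnC.
Qed.

Lemma dilK (k : nat) : (0 < k)%N -> cancel (@fps_dil R k) (fps_dec k).
Proof.
move=> k0 f; apply/fpsP => n.
by rewrite -[LHS]/(fps_dil k f (k * n)%N) coef_dil dvdn_mulr // mulKn.
Qed.

Lemma dil_dil (j k : nat) f : (0 < j)%N -> (0 < k)%N ->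
  fps_dil j (fps_dil k f) = fps_dil (j * k) f.
Proof.
move=> j0 k0; apply/fpsP => n; rewrite !coef_dil.
have [/dvdnP[m ->]|nj] := boolP (j %| n)%N.
  by rewrite mulnK // [(m * j)%N]mulnC dvdn_pmul2l // divnMl.
by rewrite ifN //; apply: contra nj; apply: dvdn_trans; rewrite dvdn_mulr.
Qed.

Lemma neg_dil_even (k : nat) f : ~~ odd k -> fps_neg (fps_dil k f) = fps_dil k f.
Proof.
move=> ke; apply/fpsP => n; rewrite coef_neg coef_dil.
case: ifP => [/dvdnP[m ->]|]; last by rewrite mulr0.
by rewrite -signr_odd oddM (negbTE ke) andbF mul1r.
Qed.

Lemma coef_qX (k n : nat) : ('q ^+ k : {fps R}) n = (n == k)%:R.
Proof.
rewrite -['q ^+ k]mulr1 coef_fpsXnM coef_fps1; case: ltnP => nk.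
  by rewrite ltn_eqF.
by rewrite subn_eq0 eqn_leq nk andbT.
Qed.

Lemma dil_q (k : nat) : (0 < k)%N -> fps_dil k 'q = 'q ^+ k :> {fps R}.
Proof.
move=> k0; apply/fpsP => n; rewrite coef_dil coef_qX.
have [/dvdnP[m ->]|nk] := boolP (k %| n)%N.
  by rewrite mulnK // -[RHS]/(((m * k)%N == k)%:R) -{2}[k]mul1n eqn_pmul2r.
by case: eqP nk => // ->; rewrite dvdnn.
Qed.

Lemma neg_q : fps_neg 'q = - 'q :> {fps R}.
Proof.
apply/fpsP => n; rewrite coef_neg coef_fpsN -['q]expr1 coef_qX.
by case: n => [|[|n]]; rewrite ?expr1 ?mulN1r //= ?mulr0 ?oppr0.
Qed.

Lemma mulqI : injective (fun f : {fps R} => 'q * f).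
Proof.
by move=> f g /fpsP fg; apply/fpsP => n; move: (fg n.+1); rewrite !coef_fpsXM.
Qed.

End Substitutions.

(** * Truncation and infinite products *)

Section Congruence.
Variable R : comNzRingType.
Implicit Types f g : {fps R}.

(** Congruence modulo q^N: identities between infinite products are checked modulo every q^N, on
    finite products. *)
Definition fps_eqm (N : nat) f g := forall n, (n < N)%N -> f n = g n.

Lemma eqmP f g : (forall N, fps_eqm N f g) -> f = g.
Proof. by move=> fg; apply/fpsP => n; apply: (fg n.+1). Qed.

Lemma eqm_refl (N : nat) f : fps_eqm N f f.
Proof. by []. Qed.

Lemma eqm_sym (N : nat) f g : fps_eqm N f g -> fps_eqm N g f.
Proof. by move=> fg n nN; rewrite fg. Qed.

Lemma eqm_trans (N : nat) g f h : fps_eqm N f g -> fps_eqm N g h -> fps_eqm N f h.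
Proof. by move=> fg gh n nN; rewrite fg // gh. Qed.

Lemma eqm_le (M N : nat) f g : (M <= N)%N -> fps_eqm N f g -> fps_eqm M f g.
Proof. by move=> MN fg n nM; apply: fg; apply: leq_trans nM MN. Qed.

Lemma eqmD (N : nat) f f' g g' :
  fps_eqm N f f' -> fps_eqm N g g' -> fps_eqm N (f + g) (f' + g').
Proof. by move=> ff gg n nN; rewrite !coef_fpsD ff ?gg. Qed.

Lemma eqmN (N : nat) f g : fps_eqm N f g -> fps_eqm N (- f) (- g).
Proof. by move=> fg n nN; rewrite !coef_fpsN fg. Qed.

Lemma eqmM (N : nat) f f' g g' :
  fps_eqm N f f' -> fps_eqm N g g' -> fps_eqm N (f * g) (f' * g').
Proof.
move=> ff gg n nN; rewrite !coef_fpsM; apply: eq_bigr => i _.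
rewrite ff ?gg ?(leq_ltn_trans (leq_subr _ _)) //.
by rewrite (leq_trans (ltn_ord i)).
Qed.

Lemma eqmX (N k : nat) f g : fps_eqm N f g -> fps_eqm N (f ^+ k) (g ^+ k).
Proof.
by move=> fg; elim: k => [|k IH]; rewrite ?expr0 // !exprS; apply: eqmM.
Qed.

Lemma eqm_dil (N k : nat) f g : (0 < k)%N ->
  fps_eqm N f g -> fps_eqm N (fps_dil k f) (fps_dil k g).
Proof.
move=> k0 fg n nN; rewrite !coef_dil; case: ifP => // _.
by rewrite fg // (leq_ltn_trans (leq_div _ _)).
Qed.

Lemma eqm_neg (N : nat) f g : fps_eqm N f g -> fps_eqm N (fps_neg f) (fps_neg g).
Proof. by move=> fg n nN; rewrite !coef_neg fg. Qed.

Lemma qpoch_approx (a b N M : nat) : (0 < a)%N -> (0 < b)%N -> (N <= M)%N ->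
  fps_eqm N (qpoch a b : {fps R}) (\prod_(m < M) (1 - 'q ^+ (a + b * m))).
Proof. by move=> a0 b0 NM n nN; apply: qpochE => //; apply: leq_trans NM. Qed.

Lemma qpoch_coef0 (a b : nat) : (0 < a)%N -> (qpoch a b : {fps R}) 0%N = 1.
Proof.
move=> a0; rewrite /qpoch /fps_prod_inf /= big_ord1 muln0 addn0.
by rewrite coef_fpsB coef_qX coef_fps1 (ltn_eqF a0) subr0.
Qed.

Lemma dil_qpoch (k a b : nat) : (0 < k)%N -> (0 < a)%N -> (0 < b)%N ->
  fps_dil k (qpoch a b) = qpoch (k * a) (k * b) :> {fps R}.
Proof.
move=> k0 a0 b0; apply: eqmP => N.
have kab : (0 < k * a)%N && (0 < k * b)%N by rewrite !muln_gt0 k0 a0.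
case/andP: kab => ka kb.
apply: eqm_trans (eqm_sym (qpoch_approx ka kb (leqnn N))).
apply: eqm_trans (eqm_dil k0 (qpoch_approx a0 b0 (leqnn N))) _ => n _.
rewrite rmorph_prod; congr (fps_coef _ n); apply: eq_bigr => i _.
by rewrite rmorphB rmorph1 rmorphXn /= dil_q // -exprM mulnDr mulnA.
Qed.

Lemma prod_even_odd (F : nat -> {fps R}) (N : nat) :
  \prod_(m < (2 * N)%N) F m = \prod_(m < N) F (2 * m)%N * \prod_(m < N) F (2 * m).+1.
Proof.
elim: N => [|N IH]; first by rewrite muln0 !big_ord0 mulr1.
by rewrite mulnS !big_ord_recr /= IH; ring.
Qed.

Lemma qpoch11_split : qpoch 1 1 = qpoch 1 2 * qpoch 2 2 :> {fps R}.
Proof.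
apply: eqmP => N; apply: eqm_trans (@qpoch_approx 1 1 N (2 * N)%N _ _ _) _ => //.
  by rewrite leq_pmull.
apply: eqm_sym; apply: eqm_trans (eqmM (@qpoch_approx 1 2 N N _ _ _)
  (@qpoch_approx 2 2 N N _ _ _)) _ => // n _; congr (fps_coef _ n).
rewrite (prod_even_odd (fun m => 1 - 'q ^+ (1 + 1 * m))); congr (_ * _); apply: eq_bigr => i _.
  by rewrite mul1n.
by rewrite mul1n.
Qed.

(** For odd m the sign change turns 1 - q^m into 1 + q^m, and (1 - q^m) (1 + q^m) = 1 - q^(2 m). *)
Lemma qpoch12_neg :
  qpoch 1 2 * fps_neg (qpoch 1 2) = fps_dil 2 (qpoch 1 2) :> {fps R}.
Proof.
rewrite dil_qpoch //; apply: eqmP => N.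
apply: eqm_trans (eqmM (@qpoch_approx 1 2 N N _ _ _)
  (eqm_neg (@qpoch_approx 1 2 N N _ _ _))) _ => //.
apply: eqm_trans (eqm_sym (@qpoch_approx (2 * 1) (2 * 2) N N _ _ _)) => //.
move=> n _; congr (fps_coef _ n); rewrite rmorph_prod -big_split /=.
apply: eq_bigr => i _; rewrite rmorphB rmorph1 rmorphXn /= neg_q.
rewrite exprNn -signr_odd oddD oddM /= expr1.
by rewrite -mulnA -mulnDr [(2 * (1 + _))%N]mulnC exprM; ring.
Qed.

End Congruence.

Section CoefficientMap.
Variables (R S : comNzRingType) (phi : {rmorphism R -> S}).

Definition fps_map (f : {fps R}) : {fps S} := Fps (fun n => phi (f n)).

Lemma fps_map_is_zmod_morphism : zmod_morphism fps_map.
Proof. by move=> f g; apply/fpsP => n /=; rewrite rmorphB. Qed.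

Lemma fps_map_is_monoid_morphism : GRing.monoid_morphism fps_map.
Proof.
split; first by apply/fpsP => n; rewrite /= rmorph_nat.
move=> f g; apply/fpsP => n; rewrite /= rmorph_sum.
by apply: eq_bigr => i _; rewrite rmorphM.
Qed.

HB.instance Definition _ :=
  GRing.isZmodMorphism.Build {fps R} {fps S} fps_map fps_map_is_zmod_morphism.
HB.instance Definition _ :=
  GRing.isMonoidMorphism.Build {fps R} {fps S} fps_map fps_map_is_monoid_morphism.

Lemma map_q : fps_map 'q = 'q.
Proof. by apply/fpsP => n /=; rewrite rmorph_nat. Qed.

Lemma map_qpoch (a b : nat) : fps_map (qpoch a b) = qpoch a b.
Proof.
apply/fpsP => n; rewrite /= -[LHS]/(fps_map (\prod_(m < n.+1) (1 - 'q ^+ (a + b * m))) n).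
rewrite rmorph_prod; congr (fps_coef _ n); apply: eq_bigr => i _.
by rewrite rmorphB rmorph1 rmorphXn /= map_q.
Qed.

End CoefficientMap.

Lemma d7_series : Fps d7 * qpoch 1 1 ^+ 22 = qpoch 2 2 ^+ 7 :> {fps int}.
Proof.
apply: eqmP => N.
have d7N : fps_eqm N (Fps d7) (\prod_(m < N) d7_factor m.+1).
  by move=> n nN; apply: d7E.
apply: eqm_trans (eqmM d7N (eqmX 22 (@qpoch_approx _ 1 1 N N _ _ _))) _ => //.
apply: eqm_trans (eqm_sym (eqmX 7 (@qpoch_approx _ 2 2 N N _ _ _))) => // n _.
congr (fps_coef _ n); rewrite -!prodrXl -big_split; apply: eq_bigr => i _ /=.
rewrite /d7_factor mul1n -mulnS divrK ?unitrX // fps_unitE coef_fpsB coef_qX.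
by rewrite coef_fps1 subr0 unitr1.
Qed.

(** * Theta series *)

(* With [v k = 1 / (1 + z^k)], the product is [P_n / P_s] for
   [P_n = \prod_(1 <= k <= n) (1 - z^k) / (1 + z^k)]; only the term [s = 0] survives as
   [n] tends to infinity. *)
Lemma shanks_identity (A : comNzRingType) (z : A) (v : nat -> A) (n : nat) :
  (forall k, (1 + z ^+ k) * v k = 1) ->
  \sum_(s < n.+1) 2 * (-1) ^+ s * z ^+ (s * n.+1) * v s
      * \prod_(s <= k < n) ((1 - z ^+ k.+1) * v k.+1)
    = (\sum_(s < n.+1) 2 * (-1) ^+ s * z ^+ (s * s)) - 1.
Proof.
move=> hv; have v0 : 2 * v 0%N = 1 by have := hv 0%N; rewrite expr0.
elim: n => [|n IH].
  rewrite !big_ord1 big_geq // !mul0n !expr0 !mulr1 v0.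
  by ring.
pose Q s := \prod_(s <= k < n) ((1 - z ^+ k.+1) * v k.+1).
pose T m s := 2 * (-1) ^+ s * z ^+ (s * m.+1) * v s
  * \prod_(s <= k < m) ((1 - z ^+ k.+1) * v k.+1).
(* Telescoping certificate: T (n+1) s - T n s = G (s+1) - G s. The value 0 at s = 0 agrees with the
   factor 1 - z^0 that Q (-1) would contain. *)
pose G s := 2 * v n.+1 * (-1) ^+ s * z ^+ (s * n.+1) * (if s is s'.+1 then Q s' else 0).
rewrite big_ord_recr [in RHS]big_ord_recr /= addrAC -IH big_geq // mulr1.
have -> : \sum_(s < n.+1) T n.+1 s = \sum_(s < n.+1) T n s + (G n.+1 - G 0%N).
  apply/eqP; rewrite addrC -subr_eq -sumrB; apply/eqP.
  rewrite -(big_mkord xpredT (fun s => T n.+1 s - T n s)).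
  apply: telescope_sumr_eq => // s /=; rewrite ltnS => sn.
  rewrite /T big_nat_recr //= -/(Q s) {}/G.
  have -> : (if s is s'.+1 then Q s' else 0) = (1 - z ^+ s) * v s * Q s.
    case: s sn => [|s] sn; first by rewrite expr0 subrr !mul0r.
    by rewrite /Q big_ltn.
  rewrite mulnS mulSn !exprD [(-1) ^+ s.+1]exprS.
  set X := z ^+ s; set Y := z ^+ n.+1; set Z := z ^+ (s * n.+1).
  apply/eqP; rewrite -subr_eq0; apply/eqP.
  transitivity (2 * (-1) ^+ s * Z * Q s *
    (v s * ((1 + Y) * v n.+1 - 1) - v n.+1 * Y * ((1 + X) * v s - 1))); first by ring.
  by rewrite !hv !subrr !mulr0 subrr mulr0.
(* The boundary term G (n+1) and the new summand s = n+1 combine into the new square term. *)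
rewrite -addrA; congr (_ + _); rewrite /G mulr0 subr0 /Q big_geq // mulr1.
rewrite (mulnS n.+1 n.+1) exprD [(-1) ^+ _]exprS.
apply/eqP; rewrite -subr_eq0; apply/eqP.
transitivity (2 * (-1) * (-1) ^+ n * z ^+ (n.+1 * n.+1) * ((1 + z ^+ n.+1) * v n.+1 - 1)).
  by ring.
by rewrite hv subrr mulr0.
Qed.

Lemma qpoch_unit (a b : nat) : (0 < a)%N -> (qpoch a b : {fps rat}) \is a GRing.unit.
Proof. by move=> a0; rewrite fps_unitE qpoch_coef0. Qed.

(* [phim] is phi(-q), as the product (q; q)^2 / (q^2; q^2), and [phi] is phi(q). *)
Definition phim : {fps rat} := qpoch 1 2 ^+ 2 * qpoch 2 2.
Definition phi : {fps rat} := fps_neg phim.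
(** Since C(t+1, 2) >= t, the terms with t <= n already determine the coefficient of q^n. *)
Definition psi : {fps rat} := Fps (fun n => (\sum_(t < n.+1) 'q ^+ 'C(t.+1, 2)) n).

Lemma phim_approx (n : nat) :
  fps_eqm n phim (\sum_(s < n.+1) 2 * (-1) ^+ s * 'q ^+ (s * s) - 1).
Proof.
pose v k : {fps rat} := (1 + 'q ^+ k)^-1.
have hv k : (1 + 'q ^+ k) * v k = 1.
  rewrite divrr // fps_unitE coef_fpsD coef_qX coef_fps1.
  by case: k => [|k].
rewrite -(shanks_identity n hv) big_ord_recl mul0n !expr0 !mulr1.
have -> : 2 * v 0%N = 1 by have := hv 0%N; rewrite expr0.
rewrite mul1r -[phim]addr0; apply: eqmD; last first.
  (* For s >= 1 the factor q^(s (n+1)) kills the term modulo q^n. *)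
  move=> k kn; rewrite coef_fps0 coef_fps_sum big1 // => i _.
  rewrite lift0 mulSn exprD [2 * _ * _]mulrC -!mulrA coef_fpsXnM.
  by rewrite ltnS (ltnW kn).
set Q := \prod_(0 <= k < n) _.
pose r : {fps rat} := \prod_(0 <= k < n) (1 + 'q ^+ k.+1).
pose p : {fps rat} := \prod_(0 <= k < n) (1 - 'q ^+ k.+1).
have Qr : Q * r = p.
  rewrite /Q /r /p -big_split; apply: eq_bigr => k _ /=.
  by rewrite -mulrA [v _ * _]mulrC hv mulr1.
have f1p : fps_eqm n (qpoch 1 1) p.
  apply: eqm_trans (@qpoch_approx _ 1 1 n n _ _ _) _ => // k _.
  rewrite /p big_mkord; congr (fps_coef _ k); apply: eq_bigr => i _.
  by rewrite mul1n add1n.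
have f2p : fps_eqm n (qpoch 2 2) (p * r).
  apply: eqm_trans (@qpoch_approx _ 2 2 n n _ _ _) _ => // k _.
  rewrite /p /r -big_split big_mkord; congr (fps_coef _ k); apply: eq_bigr => i _ /=.
  by rewrite -mulnS mulnC exprM; ring.
have f2u := @qpoch_unit 2 2 isT.
(* After multiplication by (q^2; q^2), congruent to p r, both sides are congruent to p^2, that is to
   (q; q)^2. *)
rewrite -[phim](mulrK f2u) -[Q](mulrK f2u); apply: eqmM => //.
apply: eqm_trans (eqm_sym (eqmM (@eqm_refl _ n Q) f2p)).
rewrite [Q * _]mulrCA Qr; apply: eqm_trans (eqmM f1p f1p).
by rewrite qpoch11_split /phim => k _; congr (fps_coef _ k); ring.
Qed.

Lemma psi_approx (N M : nat) :
  (N <= M)%N -> fps_eqm N psi (\sum_(t < M) 'q ^+ 'C(t.+1, 2)).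
Proof.
move=> NM n nN; have {N NM nN}nM := leq_trans nN NM.
rewrite /psi /=; elim: M nM => // M IH; rewrite ltnS leq_eqVlt => /orP[/eqP->//|nM].
rewrite IH // [in RHS]big_ord_recr coef_fpsD coef_qX ltn_eqF ?addr0 //.
by rewrite binS bin1 (leq_trans nM) ?leq_addl.
Qed.

(* Squares of even numbers are [0 mod 4], squares of odd ones are [8 C(t+1, 2) + 1]. *)
Lemma phim_dissection : phim = fps_dil 4 phi - 2 * 'q * fps_dil 8 psi.
Proof.
apply: eqmP => N.
(* At this order there are 2 (N + 1) summands, which pair up into even and odd s. *)
apply: eqm_trans (eqm_le _ (@phim_approx (2 * N).+1)) _; first by lia.
apply: eqm_trans (eqm_sym (eqmD (eqm_dil _ (eqm_neg (@phim_approx N)))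
  (eqmN (eqmM (@eqm_refl _ N (2 * 'q)) (eqm_dil _ (psi_approx (leqnSn N))))))) => //.
move=> k _; congr (fps_coef _ k).
rewrite !rmorphB !rmorph1 /= !rmorph_sum (_ : (2 * N).+2 = (2 * N.+1)%N); last by rewrite mulnS.
rewrite addrAC; congr (_ - _); elim: N.+1 => [|M IH].
  by rewrite !big_ord0 mulr0 subr0.
rewrite mulnS !big_ord_recr /= IH !rmorphM !rmorphXn !rmorphN !rmorph1 /=.
rewrite !rmorph_nat !dil_q // neg_q rmorphN /= dil_q // -!exprM.
have -> : ((2 * M).+1 * (2 * M).+1 = (8 * 'C(M.+1, 2)).+1)%N.
  have := mul_bin_diag M.+1 1; rewrite !bin1 /=; lia.
have e1 : (-1) ^+ (2 * M) = 1 :> {fps rat} by rewrite -signr_odd oddM.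
have e2 : (-1) ^+ M * (-1) ^+ (M * M) = 1 :> {fps rat}.
  by rewrite -exprD -signr_odd oddD oddM andbb addbb.
rewrite [(- 'q ^+ 4) ^+ _]exprNn -exprM [(-1) ^+ (2 * M).+1]exprS e1.
rewrite -[2 * (-1) ^+ M * _]mulrA [(-1) ^+ M * (_ * _)]mulrA e2 ['q ^+ _.+1]exprS.
rewrite (_ : (4 * (M * M) = 2 * M * (2 * M))%N); last by lia.
ring.
Qed.

(** * Theta function identities and the product for psi *)

Lemma natr_unit_fps (n : nat) : (n.+1%:R : {fps rat}) \is a GRing.unit.
Proof. by rewrite fps_unitE coef_fps_nat /= unitfE pnatr_eq0. Qed.

Lemma dil_inj (k : nat) (f g : {fps rat}) :
  (0 < k)%N -> fps_dil k f = fps_dil k g -> f = g.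
Proof. by move=> k0 /(congr1 (fps_dec k)); rewrite !dilK. Qed.

Lemma dil_unit (k : nat) (f : {fps rat}) :
  (fps_dil k f \is a GRing.unit) = (f \is a GRing.unit).
Proof. by rewrite !fps_unitE coef_dil dvdn0 div0n. Qed.

Lemma qpoch22 : qpoch 2 2 = fps_dil 2 (qpoch 1 2) * qpoch 4 4 :> {fps rat}.
Proof.
have -> : qpoch 2 2 = fps_dil 2 (qpoch 1 1) :> {fps rat} by rewrite dil_qpoch.
by rewrite qpoch11_split rmorphM /= (@dil_qpoch _ 2 2 2).
Qed.

Lemma qpoch44 : qpoch 4 4 = fps_dil 4 (qpoch 1 2) * qpoch 8 8 :> {fps rat}.
Proof.
have -> : qpoch 4 4 = fps_dil 4 (qpoch 1 1) :> {fps rat} by rewrite dil_qpoch.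
by rewrite qpoch11_split rmorphM /= (@dil_qpoch _ 4 2 2).
Qed.

Lemma phiE : phi = fps_neg (qpoch 1 2) ^+ 2 * qpoch 2 2.
Proof.
rewrite /phi /phim rmorphM rmorphXn /=; congr (_ * _).
have -> : qpoch 2 2 = fps_dil 2 (qpoch 1 1) :> {fps rat} by rewrite dil_qpoch.
by rewrite neg_dil_even.
Qed.

Lemma phim_unit : phim \is a GRing.unit.
Proof. by rewrite unitrM unitrX ?qpoch_unit. Qed.

Lemma phi_unit : phi \is a GRing.unit.
Proof. by rewrite /phi fps_unitE coef_neg mul1r -fps_unitE phim_unit. Qed.

Lemma phi_phim : phi * phim = fps_dil 2 phim ^+ 2.
Proof.
have phimE2 : fps_dil 2 phim = fps_dil 2 (qpoch 1 2) ^+ 2 * qpoch 4 4.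
  by rewrite /phim rmorphM rmorphXn /= (@dil_qpoch _ 2 2 2).
rewrite phimE2 phiE /phim; transitivity
  ((qpoch 1 2 * fps_neg (qpoch 1 2)) ^+ 2 * (qpoch 2 2 : {fps rat}) ^+ 2); first by ring.
by rewrite qpoch12_neg qpoch22; ring.
Qed.

Lemma phi_dissection : phi = fps_dil 4 phi + 2 * 'q * fps_dil 8 psi.
Proof.
rewrite {1}/phi phim_dissection rmorphB !rmorphM /= !neg_dil_even // neg_q rmorph_nat.
by ring.
Qed.

(** After q -> q^2 the left side is phi(q) phi(-q), a difference of squares by the two
    4-dissections. *)
Lemma phim_sqr : phim ^+ 2 = fps_dil 2 phi ^+ 2 - 4 * 'q * fps_dil 4 psi ^+ 2.
Proof.
apply: (@dil_inj 2) => //; rewrite /= rmorphXn /= -phi_phim.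
rewrite rmorphB !(rmorphXn, rmorphM) /= !dil_dil // dil_q // rmorph_nat.
by rewrite {1}phi_dissection phim_dissection; ring.
Qed.

Lemma phi_sqr : phi ^+ 2 = fps_dil 2 phi ^+ 2 + 4 * 'q * fps_dil 4 psi ^+ 2.
Proof.
rewrite {1}/phi -rmorphXn /= phim_sqr rmorphB !(rmorphXn, rmorphM) /= !neg_dil_even //.
by rewrite neg_q rmorph_nat; ring.
Qed.

(** Two evaluations of phi(q)^2 - phi(-q)^2: the formulas for the squares give 8 q psi(q^4)^2, the
    dissections give 8 q phi(q^4) psi(q^8). *)
Lemma psi_sqr : psi ^+ 2 = phi * fps_dil 2 psi.
Proof.
apply: (@dil_inj 4) => //; apply: mulqI; rewrite /=; apply: (mulrI (natr_unit_fps 7)).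
rewrite rmorphXn rmorphM /= dil_dil //.
transitivity (phi ^+ 2 - phim ^+ 2); first by rewrite phi_sqr phim_sqr; ring.
by rewrite {1}phi_dissection phim_dissection; ring.
Qed.

Lemma phi_sqrB : phi ^+ 2 - phim ^+ 2 = 8 * 'q * fps_dil 4 psi ^+ 2.
Proof. by rewrite phi_sqr phim_sqr; ring. Qed.

(** Jacobi's quartic identity, by factoring the left side as a difference of squares. *)
Lemma phi_quarticB : phi ^+ 4 - phim ^+ 4 = 16 * 'q * fps_dil 2 psi ^+ 4.
Proof.
have /(congr1 (fps_dil 2)) : psi ^+ 2 ^+ 2 = (phi * fps_dil 2 psi) ^+ 2.
  by rewrite psi_sqr.
rewrite !rmorphXn rmorphM /= dil_dil // -exprM => ->.
transitivity ((phi ^+ 2 - phim ^+ 2) * (phi ^+ 2 + phim ^+ 2)); first by ring.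
by rewrite phi_sqrB phi_sqr phim_sqr; ring.
Qed.

(** For n > 0, comparing coefficients of q^n equates 2 f_n plus products of lower coefficients with
    0 or f_(n/2); by induction this forces f_n = 0. *)
Lemma sqr_eq_dil2 (f : {fps rat}) : f 0%N = 1 -> f ^+ 2 = fps_dil 2 f -> f = 1.
Proof.
move=> f0 f2; apply/fpsP => n; rewrite coef_fps1; elim/ltn_ind: n => [[|n] IH] //.
have /fpsP/(_ n.+1) := f2; rewrite expr2 coef_fpsM coef_dil big_ord_recl big_ord_recr.
rewrite /= f0 subnn f0 mul1r mulr1 big1 ?add0r => [|i _]; last first.
  by rewrite /bump /= add1n IH ?mul0r // ltnS.
have -> : (if (2 %| n.+1)%N then f (n.+1 %/ 2)%N else 0) = 0.
  by case: ifP => // n2; rewrite IH ?ltn_Pdiv // gtn_eqF // divn_gt0 // dvdn_leq.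
by move/eqP; rewrite -mulr2n mulrn_eq0 => /eqP.
Qed.

(** Both sides satisfy f(q)^2 = phi(q) f(q^2) and have constant term 1, so their quotient r
    satisfies r(q)^2 = r(q^2). *)
Lemma psiE : psi = qpoch 2 2 / qpoch 1 2.
Proof.
have ou := @qpoch_unit 1 2 isT; have f2u := @qpoch_unit 2 2 isT.
have f4u := @qpoch_unit 4 4 isT.
have psi0 : psi 0%N = 1 by rewrite /psi /= big_ord1 coef_qX.
pose r := psi * qpoch 1 2 / qpoch 2 2.
have rE : psi * qpoch 1 2 = r * qpoch 2 2 by rewrite divrK.
suff r1 : r = 1 by rewrite -[LHS](mulrK ou) rE r1 mul1r.
apply: sqr_eq_dil2.
  have /(congr1 (fun f : {fps rat} => f 0%N)) := rE.
  by rewrite !coef_fpsM0 !qpoch_coef0 // psi0 !mulr1.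
have o2u : fps_dil 2 (qpoch 1 2) \is a @GRing.unit {fps rat} by rewrite dil_unit.
apply: (mulIr (unitrX 2 f2u)); rewrite -exprMn -rE exprMn psi_sqr phiE.
apply: (mulIr o2u).
have rE2 : fps_dil 2 psi * fps_dil 2 (qpoch 1 2) = fps_dil 2 r * qpoch 4 4.
  by rewrite -rmorphM rE rmorphM /= (@dil_qpoch _ 2 2 2).
transitivity ((qpoch 1 2 * fps_neg (qpoch 1 2)) ^+ 2 * qpoch 2 2
  * (fps_dil 2 psi * fps_dil 2 (qpoch 1 2))); first by ring.
by rewrite rE2 qpoch12_neg qpoch22; ring.
Qed.

(** * The parameter t and the operator T *)

Definition theta : {fps rat} := fps_dil 2 psi / phi.
Definition t : {fps rat} := 2 * 'q * fps_dil 4 theta.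
Definition tau : {fps rat} := 16 * 'q * theta ^+ 4.
(** Equal to phi(q)^2 / phi(-q)^2, by [y_phim]. *)
Definition y : {fps rat} := 1 + 8 * x.
Definition W : {fps rat} := x * (1 + 4 * x).

Lemma phi_theta : phi * theta = fps_dil 2 psi.
Proof. by rewrite /theta mulrC divrK ?phi_unit. Qed.

Lemma psi_sqr_theta : psi ^+ 2 = phi ^+ 2 * theta.
Proof. by rewrite psi_sqr -phi_theta mulrA expr2. Qed.

Lemma dil4_phi_t : fps_dil 4 phi * t = 2 * 'q * fps_dil 8 psi.
Proof.
have /(congr1 (fps_dil 4)) := phi_theta; rewrite rmorphM /= dil_dil // => <-.
by rewrite /t; ring.
Qed.

Lemma phim_t : phim = fps_dil 4 phi * (1 - t).
Proof. by rewrite mulrBr mulr1 dil4_phi_t phim_dissection. Qed.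

Lemma phi_t : phi = fps_dil 4 phi * (1 + t).
Proof. by rewrite mulrDr mulr1 dil4_phi_t -phi_dissection. Qed.

Lemma psi_mul : psi * qpoch 1 2 = qpoch 2 2.
Proof. by rewrite psiE divrK ?qpoch_unit. Qed.

Lemma x_phim : x * phim ^+ 2 = 'q * fps_dil 4 psi ^+ 2.
Proof.
have dil4_psi : fps_dil 4 psi * fps_dil 4 (qpoch 1 2) = qpoch 8 8.
  by rewrite -rmorphM psi_mul /= (@dil_qpoch _ 4 2 2).
have xE : x * (qpoch 1 1 ^+ 4 * qpoch 4 4 ^+ 2) = 'q * (qpoch 2 2 ^+ 2 * qpoch 8 8 ^+ 4).
  by rewrite /x -[LHS]mulrA divrK //  !(unitrX, unitrM) ?qpoch_unit.
have u : qpoch 2 2 ^+ 2 * qpoch 4 4 ^+ 2 \is a @GRing.unit {fps rat}.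
  by rewrite !(unitrX, unitrM) ?qpoch_unit.
apply: (mulIr u); transitivity (x * (qpoch 1 1 ^+ 4 * qpoch 4 4 ^+ 2)).
  by rewrite qpoch11_split /phim; ring.
by rewrite xE qpoch44 -dil4_psi; ring.
Qed.

Lemma x_t : 2 * x * (1 - t) ^+ 2 = t.
Proof.
have u : fps_dil 4 phi ^+ 2 \is a GRing.unit by rewrite unitrX ?dil_unit ?phi_unit.
apply: (mulrI u); transitivity (2 * (x * phim ^+ 2)); first by rewrite phim_t; ring.
rewrite x_phim -rmorphXn psi_sqr_theta rmorphM rmorphXn /= /t; ring.
Qed.

Lemma y_phim : y * phim ^+ 2 = phi ^+ 2.
Proof.
rewrite mulrDl mul1r -mulrA x_phim mulrA -phi_sqrB; ring.
Qed.

Lemma t_quartic : t ^+ 4 = fps_dil 4 tau.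
Proof. by rewrite /t /tau !(rmorphXn, rmorphM) /= dil_q // rmorph_nat; ring. Qed.

Lemma tau_phi : tau * phi ^+ 4 = phi ^+ 4 - phim ^+ 4.
Proof. by rewrite phi_quarticB -phi_theta /tau; ring. Qed.

Lemma y_sqrB : y ^+ 2 - 1 = 16 * W.
Proof. by rewrite /y /W; ring. Qed.

Lemma y_tau : y ^+ 2 * tau = 16 * W.
Proof.
apply: (mulIr (unitrX 4 phim_unit)).
transitivity (tau * (y * phim ^+ 2) ^+ 2); first by ring.
rewrite y_phim -exprM tau_phi -y_sqrB [phi ^+ 4](exprM phi 2 2) -y_phim; ring.
Qed.

Lemma y_one_minus_tau : y ^+ 2 * (1 - tau) = 1.
Proof. by rewrite mulrBr y_tau -y_sqrB mulr1 subKr. Qed.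

(** The product of the three factors is 1 - t^4, a series in q^4 with inverse y(q^4)^2. Hence 1 / (1
    - t) is a polynomial in t with coefficients in series in q^4. *)
Lemma t_inverse : (1 - t) * ((1 + t) * (1 + t ^+ 2)) * fps_dil 4 (y ^+ 2) = 1.
Proof.
transitivity (fps_dil 4 (y ^+ 2 * (1 - tau))).
  by rewrite [RHS]rmorphM rmorphB rmorph1 /= -t_quartic; ring.
by rewrite y_one_minus_tau rmorph1.
Qed.

Lemma dec4_qX (s : nat) : (s < 4)%N -> fps_dec 4 ('q ^+ s) = (s == 0%N)%:R :> {fps rat}.
Proof.
move=> s4; apply/fpsP => n; rewrite -[LHS]/(('q ^+ s : {fps rat}) (4 * n)%N) coef_qX.
case: s s4 => [|s] s4; rewrite ?coef_fps1 ?coef_fps0 ?muln_eq0 //=.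
by rewrite (_ : _ == _ = false) //; lia.
Qed.

(** As t is q times a series in q^4, the exponents of t^n are all congruent to n modulo 4. *)
Lemma dec4_tX (n : nat) :
  fps_dec 4 (t ^+ n) = if (4 %| n)%N then tau ^+ (n %/ 4) else 0.
Proof.
have -> : t ^+ n = fps_dil 4 (tau ^+ (n %/ 4) * (2 * theta) ^+ (n %% 4)) * 'q ^+ (n %% 4).
  rewrite {1}(divn_eq n 4) exprD mulnC exprM t_quartic [in RHS]rmorphM !rmorphXn /=.
  rewrite [fps_dil 4 (2 * theta)]rmorphM /= rmorph_nat -[RHS]mulrA -exprMn /t.
  by congr (_ * _ ^+ _); ring.
rewrite fps_dec_dilM // dec4_qX ?ltn_mod // /dvdn.
by case: (n %% 4)%N => [|r]; rewrite ?mulr0 // expr0 !mulr1.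
Qed.

Definition fps_eval (z : {fps rat}) (p : {poly int}) : {fps rat} := (map_poly intr p).[z].

Lemma fps_eval_is_zmod_morphism (z : {fps rat}) : zmod_morphism (fps_eval z).
Proof. by move=> p r; rewrite /fps_eval rmorphB /= hornerD hornerN. Qed.

Lemma fps_eval_is_monoid_morphism (z : {fps rat}) : GRing.monoid_morphism (fps_eval z).
Proof.
split; first by rewrite /fps_eval rmorph1 hornerC.
by move=> p r; rewrite /fps_eval rmorphM /= hornerM.
Qed.

HB.instance Definition _ (z : {fps rat}) :=
  GRing.isZmodMorphism.Build {poly int} {fps rat} (fps_eval z) (fps_eval_is_zmod_morphism z).
HB.instance Definition _ (z : {fps rat}) :=
  GRing.isMonoidMorphism.Build {poly int} {fps rat} (fps_eval z)
    (fps_eval_is_monoid_morphism z).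

Lemma fps_evalX (z : {fps rat}) : fps_eval z 'X = z.
Proof. by rewrite /fps_eval map_polyX hornerX. Qed.

Lemma fps_evalZ (z : {fps rat}) (a : int) (p : {poly int}) :
  fps_eval z (a *: p) = a%:~R * fps_eval z p.
Proof. by rewrite /fps_eval map_polyZ hornerZ. Qed.

(** The coefficient of index j comes with t^(j+1), so only j = 4 i + 3 survives U_4. *)
Lemma dec4_eval_t (h : {poly int}) (N : nat) : (size h <= 4 * N)%N ->
  fps_dec 4 (t * fps_eval t h) = \sum_(i < N) (h`_(4 * i + 3))%:~R * tau ^+ i.+1.
Proof.
move=> hN; have -> : t * fps_eval t h = \sum_(j < 4 * N) t ^+ j.+1 *~ h`_j.
  rewrite /fps_eval (@horner_coef_wide _ (4 * N)) ?mulr_sumr.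
    by apply: eq_bigr => j _; rewrite coef_map exprS mulrCA mulrzl.
  by apply: leq_trans hN; apply: size_poly.
rewrite raddf_sum /=; under eq_bigr do rewrite raddfMz /= dec4_tX.
elim: N {hN} => [|N IH]; first by rewrite !big_ord0.
rewrite mulnS -[(4 + 4 * N)%N]/(4 * N).+4 !big_ord_recr IH /=.
have -> : (4 %| (4 * N).+1)%N = false by lia.
have -> : (4 %| (4 * N).+2)%N = false by lia.
have -> : (4 %| (4 * N).+3)%N = false by lia.
have -> : (4 %| (4 * N).+4)%N by lia.
have -> : ((4 * N).+4 %/ 4 = N.+1)%N by lia.
by rewrite !mul0rz !addr0 addn3 mulrzl.
Qed.

(* The operator [f |-> P * U_4 (q * f / P)], where [P] is the prefactor of [L]. *)
Definition L_step (f : {fps rat}) : {fps rat} :=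
  phi * theta * phim ^+ 12 * fps_dec 4 ('q * (f / phim ^+ 13)).

Lemma L_step_is_zmod_morphism : zmod_morphism L_step.
Proof. by move=> f g; rewrite /L_step mulrBl mulrBr raddfB /= mulrBr. Qed.

HB.instance Definition _ :=
  GRing.isZmodMorphism.Build {fps rat} {fps rat} L_step L_step_is_zmod_morphism.

(** At X = 8 x the base 1 + X is y, and X^2 + 2 X is 16 W = y^2 tau; hence 16 W times the i-th
    product is y^(2 N) tau^(i+1). *)
Definition step_poly (N : nat) (h : {poly int}) : {poly int} :=
  \sum_(i < N) h`_(4 * i + 3) *: (('X ^+ 2 + 2 * 'X) ^+ i * (1 + 'X) ^+ (2 * (N - i.+1))).

Lemma eval_step_poly (N : nat) (h : {poly int}) :
  16 * W * fps_eval (8 * x) (step_poly N h)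
    = y ^+ (2 * N) * \sum_(i < N) (h`_(4 * i + 3))%:~R * tau ^+ i.+1.
Proof.
rewrite rmorph_sum !mulr_sumr; apply: eq_bigr => i _ /=; rewrite fps_evalZ.
rewrite mulrCA [y ^+ _ * _]mulrCA; congr (_ * _).
rewrite rmorphM !rmorphXn !rmorphD rmorphXn /= [fps_eval _ (2 * _)]rmorphM /=.
rewrite !fps_evalX rmorph1 rmorph_nat.
have -> : (8 * x) ^+ 2 + 2 * (8 * x) = 16 * W by rewrite /W; ring.
rewrite -/y mulrA -exprS -y_tau exprMn mulrAC -exprM -exprD mulrC.
by rewrite (_ : (2 * i.+1 + 2 * (N - i.+1) = 2 * N)%N) 1?mulrC // -mulnDr subnKC.
Qed.

(** By [t_inverse] the hypothesis concerns f / (1 - t)^13, hence f / phi(-q)^13 up to phi(q^4)^13.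
    The surplus 3 in the exponent is absorbed by y^6 phi(-q)^12 = phi(q)^12. *)
Lemma L_step_eval (f : {fps rat}) (h : {poly int}) (N : nat) : (size h <= 4 * N)%N ->
  f * ((1 + t) * (1 + t ^+ 2) * fps_dil 4 (y ^+ 2)) ^+ 13
    = fps_dil 4 (y ^+ 2 ^+ (N + 3)) * fps_eval t h ->
  L_step f = 8 * W * fps_eval (8 * x) (step_poly N h).
Proof.
move=> hN; set v := _ * fps_dil 4 (y ^+ 2) => fv.
have tv : (1 - t) * v = 1 by rewrite /v mulrA t_inverse.
have phi13u : phi ^+ 13 \is a GRing.unit by rewrite unitrX ?phi_unit.
have f_phim : f / phim ^+ 13 = fps_dil 4 (y ^+ 2 ^+ (N + 3) / phi ^+ 13) * fps_eval t h.
  have u : phim ^+ 13 \is a GRing.unit by rewrite unitrX ?phim_unit.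
  apply: (mulIr u); rewrite divrK // {u}phim_t.
  transitivity (fps_dil 4 (y ^+ 2 ^+ (N + 3)) * fps_eval t h * (1 - t) ^+ 13).
    by rewrite -fv -mulrA -exprMn [v * _]mulrC tv expr1n mulr1.
  rewrite -{1}[y ^+ 2 ^+ _](divrK phi13u) [fps_dil 4 (_ * _ ^+ 13)]rmorphM rmorphXn /=.
  ring.
rewrite /L_step f_phim ['q * _]mulrCA fps_dec_dilM //.
have cancel_phi : phi * phim ^+ 12 * (y ^+ 2 ^+ (N + 3) / phi ^+ 13) = y ^+ (2 * N).
  apply: (mulIr phi13u); rewrite mulrA divrK // exprM exprD.
  transitivity (phi * y ^+ 2 ^+ N * (y * phim ^+ 2) ^+ 6); first by ring.
  by rewrite y_phim; ring.
(* Cancelling the 2 in t = 2 q theta(q^4) turns 16 W into 8 W. *)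
apply: (mulrI (natr_unit_fps 1)); transitivity (16 * W * fps_eval (8 * x) (step_poly N h)).
  rewrite eval_step_poly -(dec4_eval_t hN) -cancel_phi.
  have -> : t * fps_eval t h = fps_dil 4 (2 * theta) * ('q * fps_eval t h).
    by rewrite rmorphM /= rmorph_nat /t; ring.
  by rewrite fps_dec_dilM //; ring.
ring.
Qed.

(** * The invariant lattice *)

(** The quotient (1 - X^4) / (1 - X); thus 1 / (1 - t) is its value at t times y(q^4)^2. *)
Definition cubic : {poly int} := (1 + 'X) * (1 + 'X ^+ 2).

Lemma size_1DXn (n : nat) : (size (1 + 'X^n : {poly int})%R <= n.+1)%N.
Proof. by rewrite (leq_trans (size_polyD _ _)) // size_poly1 size_polyXn geq_max leqnn. Qed.

Lemma size_cubic : (size cubic <= 4)%N.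
Proof.
apply: leq_trans (size_polyMleq _ _) _.
have := size_1DXn 1; have := size_1DXn 2; rewrite expr1; lia.
Qed.

Lemma eval_cubic (z : {fps rat}) : fps_eval z cubic = (1 + z) * (1 + z ^+ 2).
Proof. by rewrite rmorphM !rmorphD rmorphXn rmorph1 /= fps_evalX. Qed.

(** Numerator of (2 x)^k / (1 - t)^13 = t^k / (1 - t)^(13 + 2 k) once each 1 / (1 - t) is expanded
    through [cubic]. *)
Definition power_poly (k : nat) : {poly int} :=
  'X ^+ k * cubic ^+ (13 + 2 * k).

Lemma L_step_power (k : nat) :
  L_step ((2 * x) ^+ k) = 8 * W * fps_eval (8 * x) (step_poly (10 + 2 * k) (power_poly k)).
Proof.
apply: L_step_eval.
  (* The degree is at most k + 3 (13 + 2 k) = 39 + 7 k, below 4 (10 + 2 k). *)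
  apply: leq_trans (size_polyMleq _ _) _; rewrite size_polyXn.
  have := size_poly_exp_leq cubic (13 + 2 * k).
  have := size_cubic; nia.
have -> : 2 * x = t * ((1 + t) * (1 + t ^+ 2) * fps_dil 4 (y ^+ 2)) ^+ 2.
  transitivity (2 * x * ((1 - t) * ((1 + t) * (1 + t ^+ 2)) * fps_dil 4 (y ^+ 2)) ^+ 2).
    by rewrite t_inverse expr1n mulr1.
  by rewrite -{4}x_t; ring.
set v := _ * fps_dil 4 (y ^+ 2).
rewrite [(t * _) ^+ k]exprMn -[v ^+ 2 ^+ k]exprM -mulrA -[v ^+ _ * _]exprD.
rewrite (_ : (10 + 2 * k + 3 = 2 * k + 13)%N); last by lia.
rewrite /power_poly rmorphM !rmorphXn /= fps_evalX eval_cubic [(13 + _)%N]addnC.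
by rewrite /v [fps_dil 4 _]rmorphXn [(_ * _ ^+ 2) ^+ _]exprMn /=; ring.
Qed.

(** This evaluates [L 1]. Here phi(-q) / phi(q) = (1 - t) / (1 + t), and the denominator cancels one
    of the thirteen factors 1 + t that come from 1 / (1 - t)^13. *)
Lemma L_step_phim_phi :
  L_step (phim / phi) = 8 * W * fps_eval (8 * x)
    (step_poly 10 ((1 - 'X) * (1 + 'X) ^+ 12 * (1 + 'X ^+ 2) ^+ 13)).
Proof.
apply: L_step_eval.
  apply: leq_trans (size_polyMleq _ _) _.
  have := size_polyMleq (1 - 'X) ((1 + 'X) ^+ 12 : {poly int}).
  have := size_poly_exp_leq (1 + 'X : {poly int}) 12.
  have := size_poly_exp_leq (1 + 'X ^+ 2 : {poly int}) 13.
  have := size_1DXn 1; have := size_1DXn 2; rewrite expr1.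
  have -> : size (1 - 'X : {poly int}) = 2%N by rewrite -opprB size_polyN size_XsubC.
  (* [lia] does not recognize the sizes of ring expressions as atoms. *)
  set a := size _; set b := size _; set c := size _; set d := size _; set e := size _.
  lia.
have -> : phim / phi = (1 - t) * ((1 - t) * (1 + t ^+ 2) * fps_dil 4 (y ^+ 2)).
  apply: (mulIr phi_unit); rewrite divrK ?phi_unit // [LHS]phim_t [X in _ = _ * X]phi_t.
  transitivity (fps_dil 4 phi * (1 - t)
    * ((1 - t) * ((1 + t) * (1 + t ^+ 2)) * fps_dil 4 (y ^+ 2))).
    by rewrite t_inverse mulr1.
  by ring.
set z := fps_dil 4 (y ^+ 2); set v := _ * z.
transitivity ((1 - t) * ((1 - t) * ((1 + t) * (1 + t ^+ 2)) * z)
  * ((1 + t) ^+ 12 * (1 + t ^+ 2) ^+ 13 * z ^+ 13)); first by rewrite /v; ring.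
have -> : fps_eval t ((1 - 'X) * (1 + 'X) ^+ 12 * (1 + 'X ^+ 2) ^+ 13)
    = (1 - t) * (1 + t) ^+ 12 * (1 + t ^+ 2) ^+ 13.
  by rewrite 2!rmorphM !rmorphXn rmorphB !rmorphD rmorphXn rmorph1 /= fps_evalX.
rewrite t_inverse [fps_dil 4 (_ ^+ (10 + 3))]rmorphXn -/z /=; ring.
Qed.

Lemma expr_add2 (a b : {poly int}) (n : nat) :
  exists g, (a + 2 * b) ^+ n = a ^+ n + 2 * g.
Proof.
elim: n => [|n [g IH]]; first by exists 0; rewrite !expr0 mulr0 addr0.
by exists (a * g + b * a ^+ n + 2 * b * g); rewrite !exprS IH; ring.
Qed.

(* Modulo 2, [(1 + X)^2 = 1 + X^2], so the polynomial is congruent to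
   [(X + X^2) (1 + X^4)^11]. *)
Lemma power_poly1_even (i : nat) : exists c : int, (power_poly 1)`_(4 * i + 3) = 2 * c.
Proof.
(* These rewrite (1 + X)^14 = (1 + X^2 + 2 X)^7, and then (1 + X^2)^22 = (1 + X^4 + 2 X^2)^11. *)
have [g1 E1] := expr_add2 (1 + 'X ^+ 2) 'X 7.
have [g2 E2] := expr_add2 (1 + 'X ^+ 4) ('X ^+ 2) 11.
have [g ->] : exists g, power_poly 1 = 'X * (1 + 'X) * ((1 + 'X) ^+ 11 \Po 'X ^+ 4) + 2 * g.
  exists ('X * (1 + 'X) * (g2 + (1 + 'X ^+ 2) ^+ 15 * g1)).
  rewrite rmorphXn rmorphD rmorph1 /= comp_polyX.
  transitivity ('X * (1 + 'X) * (1 + 'X ^+ 2) ^+ 15 * (1 + 'X ^+ 2 + 2 * 'X) ^+ 7 : {poly int}).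
    by rewrite /power_poly /cubic; ring.
  rewrite E1; transitivity ('X * (1 + 'X) * ((1 + 'X ^+ 4 + 2 * 'X ^+ 2) ^+ 11
    + 2 * (1 + 'X ^+ 2) ^+ 15 * g1) : {poly int}); first by ring.
  by rewrite E2; ring.
exists g`_(4 * i + 3).
(* X (1 + X) times a polynomial in X^4 only has exponents 1 and 2 modulo 4. *)
rewrite coefD [2 * g]mulr_natl coefMn -mulrA coefXM addn3 /=.
rewrite mulrDl mul1r coefD coefXM /= !coef_comp_poly_Xn //.
have -> : (4 %| (4 * i).+2)%N = false by lia.
have -> : (4 %| (4 * i).+1)%N = false by lia.
by rewrite !add0r mulr_natl.
Qed.

Lemma step_poly_even (N : nat) (h : {poly int}) :
  (forall i, exists c : int, h`_(4 * i + 3) = 2 * c) ->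
  exists r, step_poly N h = 2 * r.
Proof.
move=> /choice[c hc].
exists (\sum_(i < N) c i *: (('X ^+ 2 + 2 * 'X) ^+ i * (1 + 'X) ^+ (2 * (N - i.+1)))).
rewrite /step_poly mulr_sumr; apply: eq_bigr => i _.
by rewrite hc -scalerA scaler_nat [RHS]mulr_natl.
Qed.

Definition in_lattice (f : {fps rat}) := exists s, f = W * fps_eval (8 * x) s.

Lemma in_lattice0 : in_lattice 0.
Proof. by exists 0; rewrite rmorph0 mulr0. Qed.

Lemma in_latticeD (f g : {fps rat}) : in_lattice f -> in_lattice g -> in_lattice (f + g).
Proof. by move=> [r ->] [s ->]; exists (r + s); rewrite rmorphD mulrDr. Qed.

Lemma in_latticeMz (f : {fps rat}) (a : int) : in_lattice f -> in_lattice (f *~ a).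
Proof. by move=> [r ->]; exists (r *~ a); rewrite raddfMz mulrzAr. Qed.

(** Doubling makes W (8 x)^k an integer combination of powers of 2 x, since 2 W = 2 x + 2 (2 x)^2.
    Halving the image afterwards requires 2^(2 k) r_(k+1) to be even: clear for k >= 1, and the
    evenness of r_1 for k = 0. *)
Lemma L_step_lattice_basis (k : nat) :
  exists2 g, in_lattice g & L_step (W * (8 * x) ^+ k) = 8 * g.
Proof.
have WE : 2 * (W * (8 * x) ^+ k)
    = (2 ^ (2 * k))%:R * (2 * x) ^+ k.+1 + (2 ^ (2 * k + 1))%:R * (2 * x) ^+ k.+2.
  rewrite natrX (natrX _ 2) (_ : 8 * x = 2 ^+ 2 * (2 * x)); last by ring.
  by rewrite [(2 ^+ 2 * _) ^+ k]exprMn -[2 ^+ 2 ^+ k]exprM exprD !exprS /W; ring.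
have [R2 E2] : exists R2, step_poly (10 + 2 * k.+1) (power_poly k.+1) *+ (2 ^ (2 * k)) = 2 * R2.
  case: k {WE} => [|k].
    have [R2 ->] := step_poly_even 12 power_poly1_even.
    by exists R2; rewrite mulr1n.
  exists (step_poly (10 + 2 * k.+2) (power_poly k.+2) *+ (2 ^ (2 * k + 1))).
  by rewrite mulr_natl -mulrnA -expnSr; congr (_ *+ (2 ^ _)); lia.
exists (W * fps_eval (8 * x) (R2 + step_poly (10 + 2 * k.+2) (power_poly k.+2) *+ (2 ^ (2 * k)))).
  by eexists.
apply: (mulrI (natr_unit_fps 1)).
transitivity (L_step (2 * (W * (8 * x) ^+ k))); first by rewrite !mulr_natl raddfMn.
rewrite WE !(mulr_natl _ (2 ^ _)) raddfD !raddfMn /= !L_step_power.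
rewrite rmorphD raddfMn /=; move/(congr1 (fps_eval (8 * x))): E2.
rewrite raddfMn rmorphM rmorph_nat /= => E2.
rewrite -[8 * W * _ *+ 2 ^ (2 * k)]mulrnAr E2 expnD expn1; ring.
Qed.

Lemma L_step_lattice (f : {fps rat}) : in_lattice f ->
  exists2 g, in_lattice g & L_step f = 8 * g.
Proof.
case=> r ->; rewrite -[r]coefK poly_def rmorph_sum mulr_sumr raddf_sum /=.
apply: (@big_ind _ (fun f => exists2 g, in_lattice g & f = 8 * g)) => [||i _].
- by exists 0; [apply: in_lattice0 | rewrite mulr0].
- move=> _ _ [f1 h1 ->] [f2 h2 ->]; exists (f1 + f2); last by rewrite mulrDr.
  exact: in_latticeD.
rewrite fps_evalZ mulrzl rmorphXn /= fps_evalX mulrzAr raddfMz /=.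
have [g hg ->] := L_step_lattice_basis i; exists (g *~ r`_i).
  exact: in_latticeMz.
by rewrite mulrzAr.
Qed.

(** * Arithmetic progressions and the recursion for [L] *)

Lemma lambdaE (alpha : nat) : (3 * lambda alpha = 2 * 4 ^ alpha + 1)%N.
Proof.
have [w wE] : exists w, (4 ^ alpha = 3 * w + 1)%N.
  elim: alpha => [|a [w wE]]; first by exists 0%N.
  by exists (4 * w + 1)%N; rewrite expnS wE; lia.
rewrite /lambda; case: ex_minnP => l /andP[l0 lmod] lmin.
(* 2 w + 1 is a solution, because 3 (2 w + 1) = 2 (3 w + 1) + 1. *)
have lw : (l <= 2 * w + 1)%N.
  apply: lmin; rewrite addn1 /= (_ : 3 * (2 * w).+1 = 2 * 4 ^ alpha + 1)%N.
    by rewrite modnMDl.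
  by rewrite wE; lia.
(* In 3 l - 1 = k 4^alpha, the values k = 0 and k = 1 fail modulo 3, and [lw] excludes k > 2. *)
move: lmod; rewrite eqn_mod_dvd ?muln_gt0 // => /dvdnP[[|[|k]] lk]; nia.
Qed.

Definition L_prefactor : {fps rat} := qpoch 1 1 ^+ 26 * qpoch 4 4 ^+ 2 / qpoch 2 2 ^+ 13.

Definition d7_progression (alpha : nat) : {fps rat} :=
  Fps (fun k => if k is n.+1 then (d7 (4 ^ alpha * n + lambda alpha))%:~R else 0).

Lemma L_prefactorE : L_prefactor = phim ^+ 13 * qpoch 4 4 ^+ 2.
Proof.
have u : qpoch 2 2 ^+ 13 \is a @GRing.unit {fps rat} by rewrite unitrX ?qpoch_unit.
by apply: (mulIr u); rewrite divrK // qpoch11_split /phim; ring.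
Qed.

(** Divided by phi(-q)^13, the prefactor is (q^4; q^4)^2, which leaves U_4 as (q; q)^2. The factor
    phi theta phi(-q)^12 in [L_step] is the one that restores the prefactor. *)
Lemma L_prefactor_step (g : {fps rat}) :
  L_prefactor * fps_dec 4 ('q * g) = L_step (L_prefactor * g).
Proof.
have u : phim ^+ 13 \is a @GRing.unit {fps rat} by rewrite unitrX ?phim_unit.
rewrite /L_step (_ : L_prefactor * g / phim ^+ 13 = fps_dil 4 (qpoch 1 1 ^+ 2) * g).
  rewrite ['q * (_ * g)]mulrCA fps_dec_dilM // mulrA; congr (_ * _).
  (* The extra phi produces phi^2 theta = psi^2 on one side and phi(q) phi(-q) = phi(-q^2)^2 on the
     other. *)
  rewrite L_prefactorE; apply: (mulrI phi_unit).
  transitivity (phim ^+ 12 * (phi * phim * qpoch 4 4 ^+ 2)); first by ring.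
  transitivity (phim ^+ 12 * (phi ^+ 2 * theta * qpoch 1 1 ^+ 2)); last by ring.
  congr (_ * _); rewrite -psi_sqr_theta phi_phim qpoch11_split.
  transitivity ((psi * qpoch 1 2 * qpoch 2 2) ^+ 2); last by ring.
  rewrite psi_mul /phim rmorphM rmorphXn /= (@dil_qpoch _ 2 2 2) // qpoch22.
  rewrite -[qpoch (2 * 2) (2 * 2)]/(qpoch 4 4).
  by ring.
apply: (mulIr u); rewrite divrK // L_prefactorE rmorphXn /= dil_qpoch //.
by ring.
Qed.

Lemma L_prefactor_d7 : L_prefactor * fps_map (intr : int -> rat) (Fps d7) = phim / phi.
Proof.
have := d7_series; move/(congr1 (fps_map (intr : int -> rat))).
rewrite rmorphM !rmorphXn /= !map_qpoch => E.
have u : qpoch 1 1 ^+ 22 \is a @GRing.unit {fps rat} by rewrite unitrX ?qpoch_unit.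
apply: (mulIr u); rewrite -mulrA E; apply: (mulIr phi_unit).
rewrite [RHS]mulrAC divrK ?phi_unit // L_prefactorE phiE /phim qpoch11_split.
set o := qpoch 1 2; set f2 := qpoch 2 2; set f4 := qpoch 4 4.
have oE : o * fps_neg o * f4 = f2 by rewrite qpoch12_neg -qpoch22.
transitivity (o ^+ 24 * f2 ^+ 21 * (o * fps_neg o * f4) ^+ 2); first by ring.
by rewrite oE; ring.
Qed.

(** The coefficient of q^(4 (n+1)) picks the term of index 4 n + 2, and [lambdaE] gives lambda
    (alpha+1) = lambda alpha + 2 * 4^alpha. *)
Lemma d7_progression_succ (alpha : nat) :
  d7_progression alpha.+1 = fps_dec 4 ('q * d7_progression alpha).
Proof.
apply/fpsP => n; rewrite -[RHS]/(('q * d7_progression alpha) (4 * n)%N) coef_fpsXM.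
case: n => [|n] //; rewrite (_ : 4 * n.+1 = (4 * n + 2).+2)%N; last by lia.
rewrite /=; congr (d7 _)%:~R.
have := lambdaE alpha; have := lambdaE alpha.+1; rewrite expnS; lia.
Qed.

Lemma L_lattice (alpha : nat) :
  exists2 g, in_lattice g & L alpha.+1 = 8 ^+ alpha.+1 * g.
Proof.
elim: alpha => [|alpha [f hf IH]].
  exists (W * fps_eval (8 * x)
    (step_poly 10 ((1 - 'X) * (1 + 'X) ^+ 12 * (1 + 'X ^+ 2) ^+ 13))); first by eexists.
  rewrite expr1 mulrA -L_step_phim_phi -L_prefactor_d7 -L_prefactor_step.
  (* The full generating function of [d7] starts the recursion: 4 (n + 1) - 1 = 4 n + 3 and lambda 1
     = 3. *)
  congr (_ * _); apply/fpsP => -[|n]; rewrite -[RHS]/(('q * _) (4 * _)%N) coef_fpsXM //.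
  rewrite (_ : 4 * n.+1 = (4 * n + 3).+1)%N /=; last by lia.
  by congr (d7 _)%:~R; have := lambdaE 1; lia.
have [g hg gE] := L_step_lattice hf; exists g => //.
rewrite -[L alpha.+2]/(L_prefactor * d7_progression alpha.+2) d7_progression_succ.
rewrite L_prefactor_step -[L_prefactor * _]/(L alpha.+1) IH.
have -> : L_step (8 ^+ alpha.+1 * f) = 8 ^+ alpha.+1 * L_step f.
  by rewrite -natrX !mulr_natl raddfMn.
by rewrite gE mulrA -exprSr.
Qed.

Unset Implicit Arguments.
Set Strict Implicit.

Theorem theorem1p2 (alpha : nat) (alpha_ge1 : (1 <= alpha)%N) :
  exists p : {poly int}, 1 / 8 ^+ alpha * L alpha = (map_poly intr p).[x].
Proof.
case: alpha alpha_ge1 => // alpha _.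
have [_ [s ->] ->] := L_lattice alpha.
(* W s(8 x), written as a polynomial in x. *)
exists (('X + 4 *: 'X ^+ 2) * (s \Po (8 *: 'X))).
rewrite mul1r mulKr ?unitrX ?(natr_unit_fps 7) //.
rewrite rmorphM hornerM; congr (_ * _).
  rewrite rmorphD hornerD /= map_polyZ rmorphXn /= map_polyX.
  by rewrite hornerZ hornerXn hornerX /W; ring.
by rewrite /= map_comp_poly horner_comp map_polyZ map_polyX /= hornerZ hornerX.
Qed.
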